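(* Let $\Gamma$ be a Moore graph of diameter two and degree $57$. Then the automorphism group $\operatorname{Aut}(\Gamma)$ contains no element of order $2$.
   Context: Graphs are finite, simple and undirected. A Moore graph of diameter two and degree $57$ is a $57$-regular graph of diameter two whose number of vertices attains the Moore bound, $|V(\Gamma)| = 1+57^2 = 3250$. Equivalently, it is a strongly regular graph with parameters $(3250,57,0,1)$: a $57$-regular graph on $3250$ vertices in which any two adjacent vertices have no common neighbour and any two distinct non-adjacent vertices have exactly one common neighbour. $\operatorname{Aut}(\Gamma)$ is the group of adjacency-preserving permutations of $V(\Gamma)$. The existence of such a graph is not known; the statement concerns any such graph. *)

(* Defs.v *)
From mathcomp Require Import all_boot all_fingroup.

Set Implicit Arguments.
Unset Strict Implicit.
Unset Printing Implicit Defensive.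

(* A graph on the vertex set T is given by its adjacency relation e : rel T. *)
Definition simple_graph (T : finType) (e : rel T) : Prop :=
  symmetric e /\ irreflexive e.

Definition nbhd (T : finType) (e : rel T) (x : T) : {set T} := [set y | e x y].

Definition regular_graph (T : finType) (e : rel T) (k : nat) : Prop :=
  forall x : T, #|nbhd e x| = k.

(* There is a walk of length at most n from x to y, i.e. d(x, y) <= n. *)
Definition dist_le (T : finType) (e : rel T) (n : nat) (x y : T) : Prop :=
  exists p : seq T, [/\ path e x p, last x p = y & size p <= n].

(* The graph is connected and the maximum distance, which is attained, is d. *)
Definition has_diameter (T : finType) (e : rel T) (d : nat) : Prop :=
  (forall x y : T, dist_le e d x y) /\
  (exists x y : T, forall n : nat, dist_le e n x y -> d <= n).

(* Largest possible number of vertices for degree k and diameter d: one root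
   and at most k * (k - 1) ^ i vertices at distance i + 1 from it. *)
Definition moore_bound (k d : nat) : nat := 1 + k * \sum_(i < d) (k - 1) ^ i.

Definition moore_graph (T : finType) (e : rel T) (k d : nat) : Prop :=
  [/\ simple_graph e, regular_graph e k, has_diameter e d
    & #|T| = moore_bound k d].

Lemma moore_bound_diam2 (k : nat) : 0 < k -> moore_bound k 2 = 1 + k ^ 2.
Proof.
case: k => // k _.
by rewrite /moore_bound big_ord_recr big_ord1 /= expn0 expn1 subn1 -mulnn.
Qed.

Definition graph_aut (T : finType) (e : rel T) : {set {perm T}} :=
  [set s : {perm T} | [forall x, forall y, e (s x) (s y) == e x y]].

Lemma graph_autP (T : finType) (e : rel T) (s : {perm T}) :
  reflect (forall x y, e (s x) (s y) = e x y) (s \in graph_aut e).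
Proof. by rewrite inE; apply: (iffP 'forall_'forall_eqP). Qed.

Lemma graph_aut_group_set (T : finType) (e : rel T) : group_set (graph_aut e).
Proof.
apply/group_setP; split=> [|s t /graph_autP Hs /graph_autP Ht].
  by apply/graph_autP=> x y; rewrite !perm1.
by apply/graph_autP=> x y; rewrite !permM Ht Hs.
Qed.

Canonical graph_aut_group (T : finType) (e : rel T) : {group {perm T}} :=
  Group (graph_aut_group_set e).

(* Main.v *)
Require Import Defs.
From mathcomp Require Import all_boot all_fingroup.
From mathcomp Require Import all_order all_algebra.
From mathcomp Require Import zify.

(** Let A be the adjacency matrix of the graph, J the all-ones matrix, s an
    involutory automorphism and F its set of fixed points.  The counting
    identities of a Moore graph say A ^ 2 = 56 - A + J, so A has the eigenvalues
    57, 7 and -8, and G = 65 A + 520 - J is 975 times the projection onto the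
    eigenspaces for 57 and 7.  As 975 is odd, this projection is defined over
    the 2-local integers.

    The contradiction comes from comparing two values of the trace of s on the
    image of that projection.  Over the rationals it is
    (a + 8 #|F| - 50) / 15, where a is the number of vertices adjacent to their
    image.  Modulo 2, the image is a direct summand of a permutation module of
    a group of order 2, hence itself a sum of regular and trivial modules.  The
    regular ones have trace 0, and the number of trivial ones is the rank
    modulo 2 of the block of G with rows and columns in F.  So the trace is at
    most this rank, which is [mxtrace_fix_le]; its proof replaces modules over
    the 2-local integers by a comparison of ranks over 'F_2 and over the
    rationals, for G and for the complementary matrix 975 - G at the same time.

    The fixed points are closed under taking common neighbours, so by
    [closed_star_or_regular] they are empty, or form a star, or a regular graph
    of some degree d on d ^ 2 + 1 vertices.  A vertex moved by s is either
    adjacent to its image or has exactly one fixed neighbour, which expresses a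
    through the degrees inside F ([count_involution]).  For a star with m leaves
    the trace is 210 - 16 m / 5, but the rank is at most 2 because the block is
    A + J modulo 2; this requires m >= 65, more than the degree 57.  In the
    regular case the rank is at most d ^ 2 + 1, which excludes d <= 7, while
    counting fixed neighbours excludes 8 < d < 57, and d = 8 would make the
    number of fixed points odd, although 3250 is even. *)

Set Implicit Arguments.
Unset Strict Implicit.
Unset Printing Implicit Defensive.

Import Order.TTheory GRing.Theory Num.Theory.

(** * Ranks of integer matrices modulo 2 *)

Section Rank.
Local Open Scope ring_scope.
Variable F : fieldType.

Lemma mxrank_mxsub m n m' n' (f : 'I_m' -> 'I_m) (g : 'I_n' -> 'I_n)
    (A : 'M[F]_(m, n)) : (\rank (mxsub f g A) <= \rank A)%N.
Proof.
rewrite -[A in mxsub f g A]mulmx1 mxsub_mul.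
by apply: leq_trans (mxrankM_maxl _ _) _; rewrite rowsubE mxrankM_maxr.
Qed.

Lemma exists_unit_minor m n (A : 'M[F]_(m, n)) :
  exists (f : 'I_(\rank A) -> 'I_m) (g : 'I_(\rank A) -> 'I_n),
    mxsub f g A \in unitmx.
Proof.
pose B := (rowsub (maxrankfun A) A)^T.
have fullB : row_full B by rewrite /row_full mxrank_tr [_ == _]maxrowsub_free.
exists (maxrankfun A), (fullrankfun fullB).
suff -> : mxsub (maxrankfun A) (fullrankfun fullB) A
          = (rowsub (fullrankfun fullB) B)^T.
  by rewrite unitmx_tr fullrowsub_unit.
by apply/matrixP => i j; rewrite !mxE.
Qed.

(** Writing X = C R with C of full column rank and R of full row rank, the
    identity C (R C) R = q C R cancels to R C = q, whose trace is that of X. *)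
Lemma mxrank_scaled_idem n (q : F) (X : 'M[F]_n) :
  q != 0 -> X *m X = q *: X -> q * (\rank X)%:R = \tr X.
Proof.
move=> q0 XX; set C := col_base X; set R := row_base X.
have CR : C *m R = X by rewrite mulmx_base.
suff RC : R *m C = q%:M.
  by rewrite -{2}CR mxtrace_mulC RC mxtrace_scalar mulr_natr.
have Cinj : injective (mulmx C : 'M_(\rank X, n) -> _).
  move=> Y Z /(congr1 trmx); rewrite (trmx_mul C Y) (trmx_mul C Z) => YZ.
  have freeC : row_free C^T by rewrite /row_free mxrank_tr; apply: col_base_full.
  by apply: trmx_inj; apply: (row_free_inj freeC).
apply: (row_free_inj (row_base_free X)); apply: Cinj.
by rewrite -/R -mulmxA mulmxA CR mulmxA XX mul_mx_scalar -scalemxAl CR.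
Qed.

(** The row space of X is stable under U, and U has square zero on it, with
    kernel K and image I inside K.  Since U Q = 0, the map Q factors through
    K / I on K, and K / I has dimension rank X - 2 rank (X U); since P U = 0,
    the rows of P X lie in K. *)
Lemma mxrank_square_zero n p (U X : 'M[F]_n) (P : 'M_(p, n)) (Q : 'M_(n, p)) :
    U *m U = 0 -> X *m U = U *m X -> P *m U = 0 -> U *m Q = 0 ->
  (\rank (P *m X *m Q) + 2 * \rank (X *m U) <= \rank X)%N.
Proof.
move=> UU XU PU UQ; set K := (X :&: kermx U)%MS.
have PXK : (P *m X <= K)%MS.
  by rewrite sub_capmx submxMl; apply/sub_kermxP; rewrite -mulmxA XU mulmxA PU mul0mx.
have XUK : (X *m U <= K :&: kermx Q)%MS.
  rewrite !sub_capmx {1}XU submxMl /=.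
  by apply/andP; split; apply/sub_kermxP; rewrite -mulmxA ?UU ?UQ mulmx0.
have rX := mxrank_mul_ker X U; have rK := mxrank_mul_ker K Q.
have r1 := mxrankS (submxMr Q PXK); have r2 := mxrankS XUK.
by rewrite -/K in rX; lia.
Qed.

End Rank.

(** A minor that is nonzero in F comes from a nonzero integer. *)
Lemma mxrank_intr (F : fieldType) m n (A : 'M[int]_(m, n)) :
  (\rank (map_mx intr A : 'M[F]_(m, n))
     <= \rank (map_mx intr A : 'M[rat]_(m, n)))%N.
Proof.
have [f [g]] := exists_unit_minor (map_mx intr A : 'M[F]_(m, n)).
set r := \rank _ in f g *; rewrite -map_mxsub => unitF.
suff unitQ : (map_mx intr (mxsub f g A) : 'M[rat]_r) \in unitmx.
  by rewrite -(mxrank_unit unitQ) map_mxsub mxrank_mxsub.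
move: unitF; rewrite !unitmxE !unitfE !det_map_mx intr_eq0.
by apply: contraNneq => ->.
Qed.


Section Involution.
Local Open Scope ring_scope.
Variables (n : nat) (s : 'S_n).
Hypothesis ss : involutive s.

Let Fix := [set i | s i == i].
Let half := [set i : 'I_n | (i < s i)%N].
Let f := @enum_val _ (mem Fix).

Lemma card_involution : (#|Fix| + 2 * #|half| = n)%N.
Proof.
have card_half : #|[set i : 'I_n | (s i < i)%N]| = #|half|.
  rewrite -(card_imset half (can_inj ss)); apply: eq_card => i.
  apply/idP/imsetP => [|[j]]; rewrite !inE => lt; last by move=> ->; rewrite ss.
  by exists (s i); rewrite ?inE ss.
rewrite -[RHS]card_ord -(cardsC Fix) mul2n -addnn -{2}card_half -cardsUI.
congr (_ + _)%N; rewrite [X in (_ + X)%N](_ : _ = 0%N) ?addn0.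
  by apply: eq_card => i; rewrite !inE -val_eqE neq_ltn orbC.
by apply/eqP; rewrite cards_eq0 -subset0; apply/subsetP => i; rewrite !inE; lia.
Qed.

(** The block of 1 - s with rows x and columns s x, for x < s x, is minus the
    identity. *)
Lemma mxrank_sub1_perm (F : fieldType) :
  (#|half| <= \rank (1%:M - perm_mx s : 'M[F]_n)%R)%N.
Proof.
pose h := @enum_val _ (mem half).
apply: leq_trans (mxrank_mxsub h (s \o h) _).
rewrite (_ : mxsub h _ _ = - 1%:M); first by rewrite mxrank_opp mxrank1.
apply/matrixP => i j; rewrite !mxE /= (inj_eq perm_inj) (inj_eq enum_val_inj).
rewrite (_ : (h i == s (h j)) = false) ?sub0r //.
apply/negP => /eqP fij; have := enum_valP i; have := enum_valP j.
by rewrite -/h !inE fij ss; lia.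
Qed.

(** The sum is the trace of s on the image of the projection G / q, multiplied
    by q.  Modulo 2, with U = 1 - s and X = q - G, the matrix U has square zero,
    so [mxrank_square_zero] bounds the rank of X on the fixed points by
    rank X - 2 rank (X U); that block of X and the one of G add up to the
    identity, and G U and X U add up to U, whose rank is at least the number of
    2-cycles.  Hence the block of G has rank at least
    n - rank X - 2 rank (G U).  Ranks only grow from 'F_2 to the rationals,
    where X and G U, being multiples of projections, have rank trace X / q and
    trace (G U) / 2q. *)
Lemma mxtrace_fix_le (G : 'M[int]_n) (q : nat) :
    odd q -> G *m G = q%:Z *: G -> (forall i j, G (s i) (s j) = G i j) ->
  \sum_i G i (s i)
    <= (q * \rank (map_mx intr (mxsub f f G) : 'M['F_2]_#|Fix|))%N%:Z.
Proof.
move=> oddq GG Gs; set j := \rank _.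
pose U : 'M[int]_n := 1%:M - perm_mx s.
pose X : 'M[int]_n := q%:Z%:M - G.
pose P : 'M['F_2]_(#|Fix|, n) := rowsub f 1%:M.
pose Q : 'M['F_2]_(n, #|Fix|) := colsub f 1%:M.
have sV : (s^-1)%g = s.
  by apply/permP => i; apply: (@perm_inj _ s); rewrite permKV ss.
have GU : G *m U = U *m G.
  rewrite mulmxBl mulmxBr mul1mx mulmx1 -[in RHS]row_permE -{1}sV -col_permE.
  by congr (_ - _); apply/matrixP => i k; rewrite !mxE -{1}[i]ss Gs.
have UU : U *m U = 2%:Z *: U.
  have TT : perm_mx s *m perm_mx s = 1%:M :> 'M[int]_n.
    by rewrite -perm_mxM -{1}sV mulVg perm_mx1.
  rewrite {1}/U mulmxBl mul1mx mulmxBr mulmx1 TT.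
  by apply/matrixP => i k; rewrite !mxE; lia.
pose rk2 (Y : 'M[int]_n) := \rank (map_mx intr Y : 'M['F_2]_n).
pose rkQ (Y : 'M[int]_n) := \rank (map_mx intr Y : 'M[rat]_n).
have two0 : (2%:Z)%:~R = 0 :> 'F_2 by apply/val_inj.
have q1 : (q%:Z)%:~R = 1 :> 'F_2.
  by apply/val_inj; rewrite /= -pmulrn val_Fp_nat // modn2 oddq.
have idem_rank (c : nat) (Y : 'M[int]_n) : (0 < c)%N -> Y *m Y = c%:Z *: Y ->
  (c * rkQ Y)%N%:Z = \tr Y.
  move=> c0 YY; apply: (@intr_inj rat); rewrite -trace_map_mx.
  rewrite -(@mxrank_scaled_idem _ _ c%:R) ?pnatr_eq0 -?lt0n //.
    by rewrite -[RHS]natrM pmulrn.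
  by rewrite -map_mxM YY map_mxZ.
have XX : X *m X = q%:Z *: X.
  rewrite {2}/X mulmxBr mul_mx_scalar mulmxBl mul_scalar_mx GG subrr.
  by rewrite subr0.
have rX : (q * rkQ X)%N%:Z = q%:Z * n%:Z - \tr G.
  rewrite idem_rank ?odd_gt0 //.
  by rewrite linearB /= mxtrace_scalar -mulr_natr natz.
have rGU : (2 * q * rkQ (G *m U))%N%:Z = \tr G - \sum_i G i (s i).
  have GUGU : (G *m U) *m (G *m U) = (2 * q)%N%:Z *: (G *m U).
    rewrite {2}GU mulmxA -(mulmxA G U U) UU -scalemxAr -scalemxAl -mulmxA -GU.
    by rewrite mulmxA GG -scalemxAl scalerA PoszM.
  rewrite (idem_rank _ _ _ GUGU) ?muln_gt0 ?(odd_gt0 oddq) //.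
  rewrite mulmxBr mulmx1 linearB /= -{1}sV -col_permE.
  by congr (_ - _); apply: eq_bigr => i _; rewrite mxE.
have PXQ : P *m map_mx intr X *m Q = mxsub f f (map_mx intr X).
  by rewrite -rowsubE mulmx_colsub mulmx1; apply/matrixP => i k; rewrite !mxE.
have rank_fixed : (\rank (P *m map_mx intr X *m Q) + 2 * rk2 (X *m U) <= rk2 X)%N.
  have fix_f i : s (f i) = f i by apply/eqP; have := enum_valP i; rewrite inE.
  rewrite /rk2 map_mxM; apply: mxrank_square_zero.
  - by rewrite -map_mxM UU map_mxZ /= two0 scale0r.
  - rewrite -!map_mxM; congr map_mx.
    by rewrite (mulmxBl _ _ U) (mulmxBr U) GU mul_scalar_mx mul_mx_scalar.
  - rewrite -rowsubE; apply/matrixP => i k.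
    by rewrite !mxE fix_f subrr.
  - rewrite mulmx_colsub mulmx1; apply/matrixP => i k.
    by rewrite !mxE -{2}[f k]fix_f (inj_eq perm_inj) subrr.
have sum1 : map_mx intr G + map_mx intr X = 1%:M :> 'M['F_2]_n.
  by rewrite -map_mxD addrC subrK map_scalar_mx /= q1.
have sumF : (#|Fix| <= j + \rank (P *m map_mx intr X *m Q))%N.
  rewrite -[X in (X <= _)%N](mxrank1 'F_2) PXQ /j map_mxsub.
  apply: leq_trans (mxrank_add _ _); rewrite -linearD /= sum1.
  apply: eq_leq; congr (\rank _).
  by apply/matrixP => i k; rewrite !mxE (inj_eq enum_val_inj).
have sumU : (rk2 U <= rk2 (G *m U) + rk2 (X *m U))%N.
  rewrite /rk2 !map_mxM; apply: leq_trans (mxrank_add _ _).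
  by rewrite -mulmxDl sum1 mul1mx.
have hU : (#|half| <= rk2 U)%N.
  by rewrite /rk2 map_mxB map_mx1 map_perm_mx mxrank_sub1_perm.
have cn := card_involution.
have := mxrank_intr 'F_2 X; have := mxrank_intr 'F_2 (G *m U).
rewrite -/(rk2 _) -/(rkQ _) -/(rk2 _) -/(rkQ _) => le1 le2.
have key : (n <= rkQ X + 2 * rkQ (G *m U) + j)%N by lia.
have := leq_mul (leqnn q) key; rewrite !mulnDr => qkey.
lia.
Qed.

End Involution.

(** * Graphs whose distinct vertices are joined by one path of length one or two *)

Lemma card_nbhdI (T : finType) (e : rel T) (A : {set T}) (x : T) :
  \sum_(y in A) e x y = #|nbhd e x :&: A|.
Proof.
rewrite -sum1_card [RHS]big_mkcond [LHS]big_mkcond /=.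
by apply: eq_bigr => y _; rewrite !inE andbC; case: (y \in A); case: (e x y).
Qed.

Lemma sum_nbhd (T : finType) (e : rel T) (x : T) : \sum_y e x y = #|nbhd e x|.
Proof. by rewrite -[nbhd e x]setIT -card_nbhdI; apply: eq_bigl => y; rewrite inE. Qed.

(** Diameter two makes each of the #|T| - 1 = k ^ 2 numbers at least 1, while
    counting the walks of length one and two from x shows that they add up to
    k ^ 2. *)
Lemma moore_common_nbhd (T : finType) (e : rel T) (k : nat) :
    0 < k -> moore_graph e k 2 ->
  forall x y, x != y -> #|nbhd e x :&: nbhd e y| + e x y = 1.
Proof.
move=> k0 [[sym irr] reg [dist _]]; rewrite moore_bound_diam2 // => cardT x.
have ge1 y : x != y -> 1 <= #|nbhd e x :&: nbhd e y| + e x y.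
  move=> xy; have [p [ep lp sp]] := dist x y.
  case: p ep lp sp => [|z [|w [|]]] //=.
  - by move=> _ exy; rewrite exy eqxx in xy.
  - by rewrite andbT => exz <- _; rewrite exz addn1.
  rewrite andbT => /andP[exz ezw] <- _; rewrite ltn_addr //.
  by apply/card_gt0P; exists z; rewrite !inE exz sym.
have total : \sum_(y | x != y) (#|nbhd e x :&: nbhd e y| + e x y)
             = \sum_(y | x != y) 1.
  have sume z : \sum_y e z y = k.
    by rewrite sum_nbhd reg.
  have sumN : \sum_y #|nbhd e x :&: nbhd e y| = k ^ 2.
    under eq_bigr do rewrite setIC -card_nbhdI.
    rewrite exchange_big /= -mulnn -{1}(reg x) -sum_nat_const.
    by apply: eq_bigr => z _; rewrite -(sume z); apply: eq_bigr => y _; rewrite sym.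
  have sum1 : \sum_(y : T) 1 = 1 + k ^ 2 by rewrite sum1_card.
  have splitx F : \sum_y F y = F x + \sum_(y | x != y) F y.
    by rewrite (bigD1 x) //=; congr (_ + _); apply: eq_bigl => y; rewrite eq_sym.
  rewrite big_split /=; move: sumN (sume x) sum1; rewrite !splitx setIid reg irr.
  by lia.
have /leqif_sum := fun y (xy : x != y) => leqif_eq (ge1 y xy).
rewrite -total => /leqif_refl /forall_inP eq1 y xy.
by have /eqP <- := eq1 y xy.
Qed.

Section CommonNeighbour.
Variables (T : finType) (e : rel T).
Hypothesis sym : symmetric e.
Hypothesis irr : irreflexive e.
Hypothesis mu : forall x y, x != y -> #|nbhd e x :&: nbhd e y| + e x y = 1.

Lemma triangle_free x y z : e x y -> e x z -> e y z = false.
Proof.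
move=> exy exz; apply/negP => eyz.
have xy : x != y by apply: contraTneq exy => ->; rewrite irr.
have := mu xy; rewrite exy addn1 => -[] /eqP; rewrite cards_eq0 => /eqP/setP/(_ z).
by rewrite !inE exz eyz.
Qed.

Lemma common_nbr_uniq x y z w :
  x != y -> e x z -> e y z -> e x w -> e y w -> z = w.
Proof.
move=> xy xz yz xw yw; have le1 : #|nbhd e x :&: nbhd e y| <= 1.
  by rewrite -(mu xy) leq_addr.
by apply: (card_le1_eqP le1); rewrite !inE ?xz ?yz ?xw ?yw.
Qed.

Lemma common_nbr_ex x y : x != y -> ~~ e x y -> exists2 z, e x z & e y z.
Proof.
move=> xy /negPf exy; have := mu xy; rewrite exy addn0 => /eqP/cards1P[z].
by move=> /setP/(_ z); rewrite !inE eqxx => /andP[]; exists z.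
Qed.

Section Closed.
Variable F : {set T}.
Hypothesis closedF : forall x y z, x \in F -> y \in F -> x != y ->
  e x z -> e y z -> z \in F.

Let deg x := #|nbhd e x :&: F|.

Let deg_le x y : x \in F -> y \in F -> x != y -> ~~ e x y -> deg x <= deg y.
Proof.
move=> Fx Fy xy nexy.
(* A neighbour z of x is sent to itself if it is adjacent to y and to its
   common neighbour with y otherwise. *)
pose h z := if e z y then z else odflt z [pick w | e z w && e y w].
have hP z : e x z -> if e z y then h z = z else e z (h z) && e y (h z).
  rewrite /h => exz; case: (boolP (e z y)) => // nezy.
  have zy : z != y by apply: contraNneq nexy => <-.
  have [w ezw eyw] := common_nbr_ex zy nezy.
  by case: pickP => [//|/(_ w)]; rewrite ezw eyw.
rewrite /deg -(@card_in_imset _ _ h); last first.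
  move=> z w; rewrite !inE => /andP[exz Fz] /andP[exw Fw] hzw.
  have := hP z exz; have := hP w exw; rewrite -hzw.
  case: ifP => [ewy ->|ewy /andP[ewh eyh]].
    case: ifP => [ezy zw|_ /andP[ezw _]]; first by rewrite zw.
    by rewrite (triangle_free exz exw) in ezw.
  case: ifP => [_ hz|ezy /andP[ezh _]].
    by move: ewh; rewrite hz sym (triangle_free exz exw).
  have xh : x != h z by apply: contraNneq nexy => ->; rewrite sym.
  by apply: (common_nbr_uniq xh); rewrite // sym.
apply/subset_leq_card/subsetP => _ /imsetP[z + ->]; rewrite !inE => /andP[exz Fz].
have := hP z exz; case: ifP => [ezy ->|_ /andP[ezh eyh]]; first by rewrite sym ezy.
rewrite eyh; apply: (closedF Fz Fy) ezh eyh.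
by apply: contraNneq nexy => <-.
Qed.

Let deg_nonadj x y : x \in F -> y \in F -> x != y -> ~~ e x y -> deg x = deg y.
Proof.
by move=> Fx Fy xy nexy; apply/eqP; rewrite eqn_leq !deg_le // 1?eq_sym // sym.
Qed.

(** The sum counts the walks of length two in F from x: [deg x] of them return
    to x, none ends at one of the [deg x] neighbours of x, and exactly one ends
    at each of the other members of F. *)
Lemma sum_deg_nbhd x : x \in F ->
  \sum_(y in nbhd e x :&: F) deg y = #|F|.-1.
Proof.
move=> Fx.
transitivity (\sum_(y in F) #|nbhd e x :&: F :&: nbhd e y|).
  under eq_bigr => y _ do rewrite /deg -card_nbhdI.
  rewrite exchange_big /=; apply: eq_bigr => y Fy.
  by rewrite (setIC _ (nbhd e y)) -card_nbhdI; apply: eq_bigr => z _; rewrite sym.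
have mu_in y : y \in F -> y != x -> #|nbhd e x :&: F :&: nbhd e y| + e x y = 1.
  move=> Fy; rewrite eq_sym => xy; rewrite -[RHS](mu xy); congr (#|pred_of_set _| + _).
  apply/setP => z; rewrite !inE; case exz: (e x z); case eyz: (e y z); rewrite ?andbF //=.
  by rewrite (closedF Fx Fy xy).
have degx : \sum_(y in F | y != x) e x y = deg x.
  by rewrite /deg -card_nbhdI [RHS](bigD1 x) //= irr.
have cF : \sum_(y in F | y != x) 1 = #|F|.-1.
  by rewrite -[#|F|]sum1_card [in RHS](bigD1 x).
rewrite (bigD1 x) //= setIAC setIid -/(deg x) -cF addnC -degx -big_split /=.
by apply: eq_bigr => y /andP[Fy yx]; rewrite mu_in.
Qed.

(** Two non-adjacent members of F have the same degree in F.  If no member is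
    adjacent to all others, then adjacent x and y have non-neighbours x' and y'
    in F.  One of the sequences x, y and x, x', y and x, y', y and x, x', y', y
    consists of successively equal or non-adjacent members, because otherwise
    x, y, x', y' would be a 4-cycle. *)
Lemma closed_star_or_regular x0 : x0 \in F ->
  (exists2 z, z \in F & forall x, x \in F -> x != z -> e z x) \/
  (exists d, #|F| = (d ^ 2).+1 /\ forall x, x \in F -> deg x = d).
Proof.
move=> F0; case: (boolP [exists z in F, [forall x in F, (x != z) ==> e z x]]).
  move=> /exists_inP[z Fz /forall_inP zP]; left; exists z => // x Fx xz.
  exact: (implyP (zP x Fx)).
move=> /exists_inPn nostar; right.
have nonadj x : x \in F -> exists y, [/\ y \in F, x != y & ~~ e x y].
  move=> /nostar/forall_inPn[y Fy]; rewrite negb_imply => /andP[yx nexy].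
  by exists y; rewrite eq_sym.
have reg x y : x \in F -> y \in F -> deg x = deg y.
  move=> Fx Fy; have [->//|xy] := eqVneq x y.
  have [exy|] := boolP (e x y); last exact: deg_nonadj.
  have [x' [Fx' xx' nexx']] := nonadj x Fx; have [y' [Fy' yy' neyy']] := nonadj y Fy.
  rewrite (deg_nonadj Fx Fx') // (deg_nonadj Fy Fy') //.
  have [<-//|x'y'] := eqVneq x' y'.
  have [ex'y'|] := boolP (e x' y'); last exact: deg_nonadj.
  have [xy'|xy'] := boolP (e x y'); last first.
    have [xy'E|xy'E] := eqVneq x y'.
      by rewrite sym xy'E ex'y' in nexx'.
    rewrite -(deg_nonadj Fx Fx') // (deg_nonadj Fx Fy') //.
  have [x'y|x'y] := boolP (e x' y); last first.
    have [x'yE|x'yE] := eqVneq x' y; first by rewrite x'yE exy in nexx'.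
    by rewrite (deg_nonadj Fx' Fy) // (deg_nonadj Fy Fy').
  by move: yy'; rewrite (common_nbr_uniq xx' exy x'y xy' ex'y') eqxx.
exists (deg x0); split=> [|x Fx]; last exact: reg.
have := sum_deg_nbhd F0; rewrite (eq_bigr (fun=> deg x0)); last first.
  by move=> y; rewrite inE => /andP[_ Fy]; apply: reg.
rewrite sum_nat_const mulnn => ->; rewrite prednK //.
by apply/card_gt0P; exists x0.
Qed.

End Closed.

Section Involution.
Variable s : {perm T}.
Hypothesis ss : involutive s.
Hypothesis es : forall x y, e (s x) (s y) = e x y.

Let Fix := [set x | s x == x].

Lemma fix_closed x y z : x \in Fix -> y \in Fix -> x != y ->
  e x z -> e y z -> z \in Fix.
Proof.
rewrite !inE => /eqP sx /eqP sy xy exz eyz; apply/eqP.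
by apply: (common_nbr_uniq xy); rewrite // -1?{1}sx -1?{1}sy es.
Qed.

(** If x is not adjacent to its image, the unique common neighbour of the two
    is fixed; conversely a fixed neighbour of x is adjacent to both. *)
Lemma card_fix_nbrs x : x \notin Fix -> #|nbhd e x :&: Fix| + e x (s x) = 1.
Proof.
rewrite inE eq_sym => xsx; rewrite -(mu xsx); congr (#|pred_of_set _| + _).
apply/setP => z; rewrite !inE; apply/andP/andP => -[exz].
  by move=> /eqP sz; split=> //; rewrite -sz es.
move=> esxz; split=> //; apply/eqP.
apply: (common_nbr_uniq xsx) => //; first by rewrite -[x]ss es.
by rewrite es.
Qed.

Lemma count_involution :
  #|[set x | e x (s x)]| + \sum_(f in Fix) #|nbhd e f :\: Fix| + #|Fix| = #|T|.
Proof.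
have -> : #|[set x | e x (s x)]| = \sum_(x in ~: Fix) e x (s x).
  rewrite -sum1_card big_mkcond [RHS]big_mkcond /=; apply: eq_bigr => x _.
  by rewrite !inE; case: eqP => [->|_]; rewrite ?irr //; case: (e x _).
have -> : \sum_(f in Fix) #|nbhd e f :\: Fix| = \sum_(x in ~: Fix) #|nbhd e x :&: Fix|.
  under eq_bigr do rewrite setDE -card_nbhdI; rewrite exchange_big /=.
  by apply: eq_bigr => x _; rewrite -card_nbhdI; apply: eq_bigr => y _; rewrite sym.
rewrite -big_split /= (eq_bigr (fun=> 1)) => [|x]; last first.
  by rewrite in_setC => /card_fix_nbrs; rewrite addnC.
by rewrite sum1_card addnC cardsC.
Qed.

End Involution.
End CommonNeighbour.

(** * Involutions of the Moore graph of degree 57 *)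

(** The bound by 3250 amounts to (d - 8) (57 - d) (d + 7) <= 0, so that d <= 8;
    parity excludes 8 and the last inequality the smaller values. *)
Lemma regular_fix_arith (d : nat) :
    (d ^ 2 < 3249)%N -> ~~ odd (d ^ 2).+1 ->
    ((d ^ 2).+1 * (58 - d) <= 3250)%N ->
    (65 * (3250 - (d ^ 2).+1 * (58 - d)) + 520 * (d ^ 2).+1
       <= 3250 + 975 * (d ^ 2).+1)%N ->
  False.
Proof.
move=> lt57 even_d; have d57 : (d < 57)%N by nia.
have [d7|d8] := leqP d 7; first by nia.
have [d8E|d9] : d = 8%N \/ (8 < d)%N by lia.
  by rewrite d8E in even_d.
nia.
Qed.

(** The hypotheses force m >= 65, whereas m <= 57. *)
Lemma star_fix_arith (a1 m m' j : nat) :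
    (a1 + (m' + 56 * m) + m.+1 = 3250)%N -> (m' + m = 57)%N -> (j <= 2)%N ->
  (65 * a1 + 520 * m.+1 <= 3250 + 975 * j)%N -> False.
Proof. lia. Qed.

Section MooreInvolution.
Local Open Scope ring_scope.

Lemma sum_Posz (I : finType) (P : pred I) (F : I -> nat) :
  \sum_(i | P i) (F i)%:Z = (\sum_(i | P i) F i)%N%:Z.
Proof. by rewrite (big_morph _ PoszD erefl). Qed.

Variables (n : nat) (e : rel 'I_n) (s : 'S_n).
Hypothesis sym : symmetric e.
Hypothesis irr : irreflexive e.
Hypothesis mu : forall x y, x != y -> (#|nbhd e x :&: nbhd e y| + e x y = 1)%N.
Hypothesis reg : regular_graph e 57.
Hypothesis n3250 : n = 3250%N.
Hypothesis ss : involutive s.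
Hypothesis es : forall x y, e (s x) (s y) = e x y.

Let Fix := [set i | s i == i].
Let f := @enum_val _ (mem Fix).

(** With A the adjacency and J the all-ones matrix, this is 65 A + 520 - J: it
    acts as 975 on the eigenspaces of A for 57 and 7, and as 0 on the one for
    -8.  So it is an odd multiple of a rational projection. *)
Definition moore_projector : 'M[int]_n :=
  \matrix_(i, j) (65 * (e i j)%:Z + 520 * (i == j)%:Z - 1).
Local Notation G := moore_projector.

Lemma moore_projector_idem : G *m G = 975%:Z *: G.
Proof.
pose A : 'M[int]_n := \matrix_(i, j) (e i j)%:Z.
pose J : 'M[int]_n := const_mx 1.
have degA i : \sum_j (e i j)%:Z = 57%:Z.
  by rewrite sum_Posz sum_nbhd reg.
have GE : G = 65 *: A + 520%:M - J.
  by apply/matrixP => i j; rewrite !mxE; case: eqP => _; lia.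
have AJ : A *m J = 57%:Z *: J.
  apply/matrixP => i j; rewrite !mxE -(degA i).
  by rewrite mulr1; apply: eq_bigr => k _; rewrite !mxE mulr1.
have JA : J *m A = 57%:Z *: J.
  apply/matrixP => i j; rewrite !mxE -(degA j).
  by rewrite mulr1; apply: eq_bigr => k _; rewrite !mxE mul1r sym.
have JJ : J *m J = n%:Z *: J.
  apply/matrixP => i j; rewrite !mxE (eq_bigr (fun=> 1)) => [|k _].
    by rewrite sumr_const card_ord mulr1 natz.
  by rewrite !mxE.
have AA : A *m A = 56%:M - A + J.
  apply/matrixP => i j; rewrite !mxE.
  have -> : \sum_k A i k * A k j = #|nbhd e i :&: nbhd e j|%:Z.
    rewrite -card_nbhdI -sum_Posz [RHS]big_mkcond; apply: eq_bigr => k _.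
    by rewrite !mxE inE (sym k j); case: (e j k); rewrite ?mulr1 ?mulr0.
  have [<-|ij] := eqVneq i j; first by rewrite setIid reg irr.
  by have := mu ij; lia.
rewrite GE !(mulmxDl, mulmxDr, mulNmx, mulmxN).
rewrite -!(scalemxAl, scalemxAr) !mul_scalar_mx !mul_mx_scalar.
rewrite AA AJ JA JJ (congr1 Posz n3250).
by apply/matrixP => i j; rewrite !mxE; case: eqP => _; lia.
Qed.

Lemma moore_trace_le :
  (65 * #|[set x | e x (s x)]| + 520 * #|Fix| <=
   3250 + 975 * \rank (map_mx intr (mxsub f f G) : 'M['F_2]_#|Fix|))%N.
Proof.
have Gs i j : G (s i) (s j) = G i j by rewrite !mxE es (inj_eq perm_inj).
have := mxtrace_fix_le ss (q := 975) isT moore_projector_idem Gs.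
have -> : \sum_i G i (s i) = (65 * #|[set x | e x (s x)]| + 520 * #|Fix|)%N%:Z - 3250%:Z.
  have -> : #|[set x | e x (s x)]| = (\sum_x e x (s x))%N.
    by rewrite -sum1_card big_mkcond; apply: eq_bigr => x _; rewrite inE; case: e.
  have -> : #|Fix| = (\sum_x (s x == x))%N.
    by rewrite -sum1_card big_mkcond; apply: eq_bigr => x _; rewrite inE; case: eqP.
  have -> : 3250%:Z = \sum_(x < n) 1 by rewrite sumr_const card_ord natz n3250.
  rewrite PoszD !PoszM -!sum_Posz !mulr_sumr -big_split -sumrB /=.
  by apply: eq_bigr => x _; rewrite mxE eq_sym.
rewrite -/Fix -/f; lia.
Qed.

(** Modulo 2 the matrix reduces to A + J, and on a star with centre z the entry
    of A at (x, y) is the sum of the indicators of x = z and y = z. *)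
Lemma star_rank z : z \in Fix -> (forall x, x \in Fix -> x != z -> e z x) ->
  (\rank (map_mx intr (mxsub f f G) : 'M['F_2]_#|Fix|) <= 2)%N.
Proof.
move=> Fz star.
pose c (b : bool) : 'cV['F_2]_#|Fix| := \col_i ((f i == z) (+) b)%:R.
pose o : 'cV['F_2]_#|Fix| := const_mx 1.
have rank1 (u v : 'cV['F_2]_#|Fix|) : (\rank (u *m v^T) <= 1)%N.
  exact: leq_trans (mxrankM_maxl _ _) (rank_leq_col _).
have -> : (map_mx intr (mxsub f f G) : 'M['F_2]_#|Fix|) = c false *m o^T + o *m (c true)^T.
  apply/matrixP => i j; rewrite !mxE !big_ord1 !mxE mulr1 mul1r addbF.
  have eE : e (f i) (f j) = (f i == z) (+) (f j == z).
    have Fi : f i \in Fix := enum_valP i; have Fj : f j \in Fix := enum_valP j.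
    have [->|iz] := eqVneq (f i) z; have [->|jz] := eqVneq (f j) z.
    - exact: irr.
    - exact: star.
    - by rewrite sym star.
    - exact: (triangle_free irr mu (star _ Fi iz) (star _ Fj jz)).
  have [ij|_] := eqVneq (f i) (f j).
    by rewrite eE ij addbb; apply/val_inj; case: (f j == z).
  by rewrite eE; apply/val_inj; case: (f i == z); case: (f j == z).
exact: leq_trans (mxrank_add _ _) (leq_add (rank1 _ _) (rank1 _ _)).
Qed.

Lemma moore57_involution_trivial : s = 1%g.
Proof.
have cn := card_involution ss; have count := count_involution sym irr mu ss es.
have := moore_trace_le; set j := \rank _; rewrite -/Fix in cn count *.
set a1 := #|[set x | _]| in count *; set S := (\sum_(x in _) _)%N in count.
rewrite card_ord in count.
have j_le : (j <= #|Fix|)%N by apply: rank_leq_row.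
have degD x : (#|nbhd e x :\: Fix| + #|nbhd e x :&: Fix| = 57)%N.
  by rewrite addnC -(reg x) cardsID.
have [F0|[z0 Fz0]] := set_0Vmem Fix.
  have S0 : S = 0%N by rewrite /S F0 big_set0.
  by rewrite F0 cards0 in j_le count *; lia.
have [[z Fz star]|[d [cF degF]]] :=
    @closed_star_or_regular _ _ sym irr mu Fix (fix_closed mu es) z0 Fz0.
  have j2 := star_rank Fz star; rewrite -/j in j2.
  have degz : (#|nbhd e z :&: Fix|.+1 = #|Fix|)%N.
    rewrite (cardsD1 z Fix) Fz add1n; congr _.+1; apply: eq_card => x.
    rewrite !inE; apply/andP/andP => -[].
      by move=> ezx ->; split=> //; apply: contraTneq ezx => ->; rewrite irr.
    by move=> xz sx; split=> //; apply: star; rewrite ?inE.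
  have SE : (S = #|nbhd e z :\: Fix| + 56 * #|Fix|.-1)%N.
    rewrite /S (bigD1 z) //= (cardsD1 z Fix) Fz add1n /= mulnC -sum_nat_const.
    congr (_ + _)%N; apply: congr_big => // [x|x /andP[Fx xz]].
      by rewrite !inE andbC.
    have exz : e x z by rewrite sym star.
    have NxF : nbhd e x :&: Fix = [set z].
      apply/setP => y; rewrite in_set1 inE; apply/andP/eqP => [[exy Fy]|->].
        apply/eqP; apply: contraT => yz; rewrite inE in exy.
        by move: (star y Fy yz); rewrite (triangle_free irr mu exz exy).
      by rewrite inE exz.
    by have := degD x; rewrite NxF cards1 addn1 => -[].
  have cn1 : (#|Fix|.-1 = #|nbhd e z :&: Fix|)%N by rewrite -degz.
  move=> tr; rewrite -degz in tr; rewrite SE cn1 -degz in count.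
  case: (@star_fix_arith a1 _ _ j _ (degD z) j2 tr) => //; exact: etrans count n3250.
have SE : S = (#|Fix| * (57 - d))%N.
  rewrite -sum_nat_const; apply: eq_bigr => x Fx; have := degD x; rewrite degF //.
  by lia.
have d57 : (d <= 57)%N by rewrite -(degF _ Fz0) -(degD z0) leq_addl.
move=> tr; have [FT|ltF] : #|Fix| = n \/ (#|Fix| < n)%N.
  by have := max_card (mem Fix); rewrite card_ord leq_eqVlt => /orP[/eqP|]; [left|right].
  apply/permP => i; rewrite perm1; apply/eqP.
  have /eqP FT' : Fix == setT by rewrite eqEcard subsetT cardsT card_ord FT leqnn.
  by have := in_setT i; rewrite -FT' inE.
have d58 : (58 - d = (57 - d).+1)%N by lia.
case: (@regular_fix_arith d).
- by have := leq_trans ltF (eq_leq n3250); rewrite cF.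
- have := congr1 odd (etrans cn n3250); rewrite oddD oddM addbF cF => ->.
  by [].
- have := etrans count n3250; rewrite SE cF d58 mulnS; lia.
- move: tr j_le; have := etrans count n3250; rewrite SE cF d58 mulnS; lia.
Qed.

End MooreInvolution.

Theorem theorem1p1 (T : finType) (e : rel T) :
  moore_graph e 57 2 ->
  ~ (exists s : {perm T}, s \in graph_aut e /\ #[s]%g = 2).
Proof.
move=> moore [s [/graph_autP es os]].
have [[sym irr] reg _ cT] := moore.
have mu := moore_common_nbhd (isT : 0 < 57)%N moore.
have ss : involutive s.
  by move=> x; rewrite -permM -expg2 -os expg_order perm1.
(* Numbering the vertices turns s into a permutation of row indices. *)
pose e' : rel 'I_#|T| := fun i j => e (enum_val i) (enum_val j).
have s'_inj : injective (fun i : 'I_#|T| => enum_rank (s (enum_val i))).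
  by move=> i j /enum_rank_inj/perm_inj/enum_val_inj.
have card_nbhd' i (A : {set T}) : #|nbhd e' i :&: [set j | enum_val j \in A]|
    = #|nbhd e (enum_val i) :&: A|.
  rewrite -(card_imset _ enum_val_inj); apply: eq_card => x.
  apply/imsetP/idP => [[j + ->]|]; rewrite !inE // => /andP[exi Ax].
  by exists (enum_rank x); rewrite ?inE /e' ?enum_rankK ?exi.
have : perm s'_inj = 1%g.
  apply: (@moore57_involution_trivial _ e').
  - by move=> i j; apply: sym.
  - by move=> i; apply: irr.
  - move=> i j ij; rewrite -(mu (enum_val i) (enum_val j)) ?(inj_eq enum_val_inj) //.
    rewrite -card_nbhd'; congr (#|pred_of_set _| + _)%N.
    by apply/setP => k; rewrite !inE.
  - move=> i; rewrite -(reg (enum_val i)) -[nbhd e _]setIT -card_nbhd'.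
    by apply: eq_card => k; rewrite !inE andbT.
  - by rewrite cT moore_bound_diam2.
  - by move=> i; rewrite !permE enum_rankK ss enum_valK.
  - by move=> i j; rewrite /e' !permE !enum_rankK es.
move=> s'1; have s1 : s = 1%g.
  apply/permP => x; have := congr1 (fun t : {perm 'I_#|T|} => enum_val (t (enum_rank x))) s'1.
  by rewrite /= permE !perm1 !enum_rankK.
by rewrite s1 order1 in os.
Qed.
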